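(* Let $n$ be any positive odd integer. Then $$\sum_{r=0}^{n-1}\frac{1}{1+\sin 2\pi\frac{x+r}{n}+\cos 2\pi\frac{x+r}{n}}=\frac{\left(\frac{-1}{n}\right)n}{1+\left(\frac{-1}{n}\right)\sin 2\pi x+\cos 2\pi x}$$ for any $x\in\mathbb{C}$ with $x+\frac12\notin\mathbb{Z}$ and $x+(-1)^{(n-1)/2}/4\notin\mathbb{Z}$, and $$\sum_{r=0}^{n-1}\frac{1}{1+\sin 2\pi\frac{x+r}{n}-\cos 2\pi\frac{x+r}{n}}=\frac{\left(\frac{-1}{n}\right)n}{1+\left(\frac{-1}{n}\right)\sin 2\pi x-\cos 2\pi x}$$ for all $x\in\mathbb{C}$ with $x\notin\mathbb{Z}$ and $x+(-1)^{(n-1)/2}/4\notin\mathbb{Z}$.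
   Context: For a positive odd integer $n$, $\left(\frac{\cdot}{n}\right)$ denotes the Jacobi symbol; in particular $\left(\frac{-1}{n}\right)=(-1)^{(n-1)/2}$. *)

(* Defs.v *)
From mathcomp Require Import all_boot all_order all_algebra.
From mathcomp Require Import complex.
From mathcomp Require Import reals trigo sequences exp.

Set Implicit Arguments.
Unset Strict Implicit.
Unset Printing Implicit Defensive.

Import Order.TTheory GRing.Theory Num.Theory.

Local Open Scope ring_scope.
Local Open Scope complex_scope.

(* Only meaningful for p an odd prime. *)
Definition legendre (a : int) (p : nat) : int :=
  if (p %| a)%Z then 0
  else if [exists y : 'I_p, (a == (y : nat)%:Z ^+ 2 %[mod p])%Z] then 1
  else -1.

(* Only meaningful for n odd; jacobi a 1 is the empty product 1. *)
Definition jacobi (a : int) (n : nat) : int :=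
  \prod_(pe <- prime_decomp n) legendre a pe.1 ^+ pe.2.

Definition Cexp (R : realType) (z : R[i]) : R[i] :=
  let: a +i* b := z in (expR a)%:C * (cos b +i* sin b).

Definition Csin (R : realType) (z : R[i]) : R[i] :=
  (Cexp ('i * z) - Cexp (- ('i * z))) / (2%:R * 'i).

Definition Ccos (R : realType) (z : R[i]) : R[i] :=
  (Cexp ('i * z) + Cexp (- ('i * z))) / 2%:R.

Definition Cpi (R : realType) : R[i] := (pi : R)%:C.

Definition is_Cint (R : realType) (z : R[i]) : Prop :=
  exists k : int, z = k%:~R.

Lemma Csin_real (R : realType) (a : R) : Csin a%:C = (sin a)%:C.
Proof.
have i0 : 'i != 0 :> R[i] by rewrite eq_complex /= oner_eq0 andbF.
have -> : Csin a%:C = ((sin a)%:C * (2%:R * 'i)) / (2%:R * 'i).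
  congr (_ / _); rewrite mulrA mulr_natr mulr2n -rmorphD /=.
  apply/eqP; rewrite eq_complex /=.
  rewrite !(mul0r, mul1r, mulr0, mulr1, subr0, addr0, add0r, oppr0) expR0.
  by rewrite cosN sinN !mul1r subrr !eqxx /= opprK.
by rewrite mulfK // mulf_neq0 // pnatr_eq0.
Qed.

Lemma Ccos_real (R : realType) (a : R) : Ccos a%:C = (cos a)%:C.
Proof.
have -> : Ccos a%:C = ((cos a)%:C * 2%:R) / 2%:R.
  congr (_ / _); rewrite mulr_natr mulr2n -rmorphD /=.
  apply/eqP; rewrite eq_complex /=.
  rewrite !(mul0r, mul1r, mulr0, mulr1, subr0, addr0, add0r, oppr0) expR0.
  by rewrite cosN sinN !mul1r subrr !eqxx.
by rewrite mulfK // pnatr_eq0.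
Qed.

(* Main.v *)
Require Import Defs.
From mathcomp Require Import all_boot all_order all_algebra all_field.
From mathcomp Require Import zify ring lra.
From mathcomp Require Import complex.
From mathcomp Require Import reals trigo sequences exp.

Import Order.TTheory GRing.Theory Num.Theory.

Local Open Scope ring_scope.
Local Open Scope complex_scope.

(* Put u = exp(2 pi i y).  For signs c, s in {1, -1}, partial fractions give
     c / (1 + c sin(2 pi y) + s cos(2 pi y)) = s c / (u + c i) + i / (u + s).
   For y = (x + r) / n one has u = z zeta^r with zeta = exp(2 pi i / n) and
   z^n = w := exp(2 pi i x), and summing over r uses, for n odd,
     sum_r 1 / (z zeta^r + a) = n a^(n-1) / (w + a^n).
   Take c = 1 on the left.  Since i^(n-1) = (-1)^((n-1)/2) =: c' and
   i^n = c' i, the sum is n (s c' / (w + c' i) + i / (w + s)), which is the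
   same partial fraction decomposition at w with sign c'.  Finally c' is the
   Jacobi symbol (-1/n) by multiplicativity and the prime case. *)

(** * The Jacobi symbol of -1 *)

(** Raising [y ^ 2 = -1] to the power [p./2] gives 1 by Fermat, so [p./2] is even. Conversely, a [g]
    whose power [p./2] is not 1 has that power equal to -1, which is a square when [p./2] is
    even. *)
Lemma sqr_eqN1_modp (p : nat) : prime p -> odd p ->
  (exists y : nat, (p %| y ^ 2 + 1)%N) <-> ~~ odd p./2.
Proof.
move=> p_pr p_odd; have chF := pchar_Fp p_pr.
have N1neq1 : (-1 : 'F_p) != 1.
  rewrite eq_sym -subr_eq0 opprK -(natrD _ 1 1) -(dvdn_pcharf chF).
  by apply/negP => /dvdn_leq; case: p p_pr p_odd {chF} => [|[|[|p]]] //= _ _ /(_ isT).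
have pE : p.-1 = (p./2).*2 by rewrite -{1}(odd_double_half p) p_odd.
have fermat (u : 'F_p) : u != 0 -> u ^+ (p./2).*2 = 1.
  move=> u0; rewrite -pE; apply: (mulfI u0); rewrite -exprS prednK ?prime_gt0 //.
  by rewrite mulr1 -{2}(expf_card u) card_Fp.
split=> [[y]|h_even].
  rewrite (dvdn_pcharf chF) natrD natrX addr_eq0 => /eqP y2.
  apply/negP => h_odd; case/eqP: N1neq1.
  have y0 : y%:R != 0 :> 'F_p.
    apply/eqP => y0; move/eqP: y2.
    by rewrite y0 expr0n /= eq_sym oppr_eq0 oner_eq0.
  by rewrite -[RHS](fermat _ y0) -mul2n exprM y2 -signr_odd h_odd.
have h_gt0 : (0 < p./2)%N by case: p p_pr p_odd {chF N1neq1 pE fermat h_even} => [|[|[|]]].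
(* Otherwise all [p.-1 = 2 * p./2] nonzero residues would be roots of ['X^(p./2) - 1], which has at
   most [p./2] roots. *)
have [g g0 gh] : exists2 g : 'F_p, g != 0 & g ^+ p./2 != 1.
  apply/exists_inP; rewrite -negb_forall_in; apply/negP => /forall_inP all1.
  pose rs := [seq u : 'F_p <- enum 'F_p | u != 0].
  have szX : size ('X^(p./2) - 1 : {poly 'F_p}) = (p./2).+1 by rewrite size_XnsubC.
  have := @max_poly_roots _ ('X^(p./2) - 1 : {poly 'F_p}) rs.
  rewrite -size_poly_eq0 szX; move=> /(_ isT).
  have -> : all (root ('X^(p./2) - 1 : {poly 'F_p})) rs.
    apply/allP => u; rewrite mem_filter => /andP [u0 _].
    by rewrite rootE !hornerE subr_eq0 all1.
  rewrite filter_uniq ?enum_uniq // => /(_ isT isT).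
  have -> : size rs = p.-1.
    have := cardC1 (0 : 'F_p); rewrite card_Fp // => <-.
    by rewrite cardE; congr size; rewrite {1}/enum_mem /rs enumT; apply: eq_filter.
  rewrite pE; lia.
have gN1 : g ^+ p./2 = -1.
  have /eqP := fermat g g0; rewrite -muln2 exprM sqrf_eq1 (negPf gh) /=.
  by move/eqP.
exists (val (g ^+ (p./2)./2)).
rewrite (dvdn_pcharf chF) natrD natrX natr_Zp -exprM muln2 even_halfK //.
by rewrite gN1 addNr.
Qed.

Lemma legendreN1 (p : nat) : prime p -> odd p -> legendre (-1) p = (-1) ^+ p./2.
Proof.
move=> p_pr p_odd; rewrite /legendre dvdzE /= dvdn1.
rewrite (gtn_eqF (prime_gt1 p_pr)) -signr_odd.
have sqE (y : nat) : (-1 == y%:Z ^+ 2 %[mod p])%Z = (p %| y ^ 2 + 1)%N.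
  by rewrite eq_sym eqz_mod_dvd opprK -rmorphXn -(rmorphD _ _ 1%N) dvdzE.
case: ifP => [/existsP [y]|/negbT/existsPn noy].
  rewrite sqE => py.
  suff /negPf -> : ~~ odd p./2 by [].
  by apply/(sqr_eqN1_modp p p_pr p_odd); exists y.
case: (boolP (odd p./2)) => [//|/(sqr_eqN1_modp _ p_pr p_odd).2 [y py]].
have := noy (Ordinal (ltn_pmod y (prime_gt0 p_pr))); rewrite sqE /=.
by rewrite /dvdn -modnDml modnXm modnDml -/(dvdn _ _) py.
Qed.

(** Since [mn - 1 = (m - 1) + (n - 1) + (m - 1)(n - 1)] and 4 divides the last product, halving
    gives equal parities. *)
Lemma sign_halfM (m n : nat) : odd m -> odd n ->
  (-1) ^+ (m * n)./2 = (-1) ^+ m./2 * (-1) ^+ n./2 :> int.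
Proof.
move=> m_odd n_odd; rewrite -exprD -[LHS]signr_odd -[RHS]signr_odd.
congr ((-1) ^+ nat_of_bool _); lia.
Qed.

Lemma jacobiN1 (n : nat) : odd n -> jacobi (-1) n = (-1) ^+ n./2.
Proof.
move=> n_odd; have n_gt0 := odd_gt0 n_odd; rewrite {2}(prod_prime_decomp n_gt0).
suff [_ ->] : odd (\prod_(f <- prime_decomp n) f.1 ^ f.2)%N /\
    jacobi (-1) n = (-1) ^+ (\prod_(f <- prime_decomp n) f.1 ^ f.2)%N./2 by [].
rewrite /jacobi !big_seq.
(* Oddness is carried along because the sign is multiplicative only on odd factors. *)
apply: (big_ind2 (fun m (x : int) => odd m /\ x = (-1) ^+ m./2)) => //.
  by move=> m1 _ m2 _ [o1 ->] [o2 ->]; rewrite oddM o1 o2 sign_halfM.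
case=> p e /mem_prime_decomp [p_pr _ pe_n] /=.
case: e pe_n => [//|e] pe_n.
have p_odd : odd p.
  by apply: dvdn_odd n_odd; apply: dvdn_trans pe_n; rewrite expnS dvdn_mulr.
rewrite oddX p_odd orbT legendreN1 //; split=> //.
elim: e.+1 => [//|k IH]; rewrite exprS expnS sign_halfM ?oddX ?p_odd ?orbT //.
by rewrite IH.
Qed.

(** * Sums over roots of unity and partial fractions *)

(** Multiplication by the nonzero [zeta ^+ k - 1] telescopes the sum to [zeta ^+ (k * n) - 1], which
    vanishes. *)
Lemma sum_prim_root_exp (F : fieldType) (n k : nat) (zeta : F) :
  n.-primitive_root zeta -> (0 < k < n)%N -> \sum_(r < n) (zeta ^+ r) ^+ k = 0.
Proof.
move=> prim /andP [k0 kn].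
have zk1 : zeta ^+ k - 1 != 0.
  by rewrite subr_eq0 -(prim_order_dvd prim) gtnNdvd.
apply: (mulfI zk1); rewrite mulr0.
under eq_bigr do rewrite exprAC.
by rewrite -subrX1 exprAC (prim_expr_order prim) expr1n subrr.
Qed.

(* Since [(z zeta^r)^n = z^n] does not depend on [r], each inverse is a geometric
   sum in [- z zeta^r] over the common denominator [z^n + a^n], and summing over
   [r] kills all powers but the zeroth. *)
Lemma sum_inv_prim_root (F : fieldType) (n : nat) (zeta a z : F) :
  odd n -> n.-primitive_root zeta -> z ^+ n + a ^+ n != 0 ->
  \sum_(r < n) (z * zeta ^+ r + a)^-1 = n%:R * a ^+ n.-1 / (z ^+ n + a ^+ n).
Proof.
move=> n_odd prim nz; have n_gt0 := odd_gt0 n_odd.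
have powE r : (- (z * zeta ^+ r)) ^+ n = - z ^+ n.
  rewrite exprNn -signr_odd n_odd mulN1r exprMn exprAC.
  by rewrite (prim_expr_order prim) expr1n mulr1.
have invE r : (z * zeta ^+ r + a)^-1 =
    (\sum_(k < n) a ^+ (n.-1 - k) * (- (z * zeta ^+ r)) ^+ k) / (z ^+ n + a ^+ n).
  have := subrXX a (- (z * zeta ^+ r)) n; rewrite powE !opprK.
  rewrite [a ^+ n + _]addrC [a + _]addrC => E.
  (* The summand's denominator divides [z ^+ n + a ^+ n], so it is nonzero as well. *)
  move: nz; rewrite E mulf_eq0 negb_or => /andP [d0 S0].
  rewrite /= in E S0 *.
  by rewrite invfM mulrCA mulfV ?mulr1.
under eq_bigr do rewrite invE.
rewrite -mulr_suml; congr (_ / _).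
rewrite exchange_big /= -(prednK n_gt0) big_ord_recl /= subn0.
under eq_bigr do rewrite expr0 mulr1.
rewrite sumr_const card_ord prednK // mulr_natl big1 ?addr0 // => k _.
under eq_bigr do rewrite -mulNr exprMn mulrA.
rewrite -mulr_sumr sum_prim_root_exp ?mulr0 //.
by rewrite /= -[in X in (_ < X)%N](prednK n_gt0) ltnS ltn_ord.
Qed.

(* With [u = exp (i t)], the two fractions in [u] are [sin t] and [cos t]. *)
Lemma inv_trig_partial_fractions (F : numFieldType) (i u c s : F) :
  i ^+ 2 = -1 -> u != 0 -> c ^+ 2 = 1 -> s ^+ 2 = 1 ->
  u + c * i != 0 -> u + s != 0 ->
  c / (1 + c * ((u - u^-1) / (2%:R * i)) + s * ((u + u^-1) / 2%:R)) =
  s * c / (u + c * i) + i / (u + s).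
Proof.
move=> i2 u0 c2 s2 uc us.
have i0 : i != 0.
  apply/eqP => i0; move/eqP: i2.
  by rewrite i0 expr0n /= eq_sym oppr_eq0 oner_eq0.
(* After multiplication by [2 u] the denominator is a quadratic in [u] with leading coefficient
   [s - c i] and roots [- c i] and [- s]. *)
have E : (1 + c * ((u - u^-1) / (2%:R * i)) + s * ((u + u^-1) / 2%:R)) * (2%:R * u) =
   (s - c * i) * ((u + c * i) * (u + s)).
  have -> : (2%:R * i)^-1 = - i / 2%:R.
    rewrite invfM mulrC; congr (_ / _); apply: (mulfI i0).
    by rewrite mulrN -expr2 i2 opprK divff.
  transitivity (2%:R * u - c * i * (u ^+ 2 - 1) + s * (u ^+ 2 + 1)).
    by field.
  ring: c2 s2 i2.
(* Multiplying by the conjugate [s + c i] gives [s ^+ 2 + c ^+ 2 = 2]. *)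
have d0 : s - c * i != 0.
  apply/eqP => /(congr1 (fun x => x * (s + c * i))).
  rewrite mul0r => /eqP; rewrite -subr_sqr exprMn c2 s2 mul1r i2 opprK.
  by rewrite -(natrD _ 1 1) pnatr_eq0.
set D := 1 + _ + _ in E *.
have D0 : D != 0.
  apply/eqP => D0; move/eqP: E; rewrite D0 mul0r eq_sym !mulf_eq0.
  by rewrite (negPf d0) (negPf uc) (negPf us).
have num : c * (2%:R * u) = (s - c * i) * (s * c * (u + s) + i * (u + c * i)).
  by ring: c2 s2 i2.
have -> : c / D = c * (2%:R * u) / (D * (2%:R * u)).
  by field; rewrite D0 u0.
by rewrite E num; field; rewrite us uc d0.
Qed.

(** * The exponential with period 1 *)

Lemma CexpD {R : realType} (z w : R[i]) : Cexp (z + w) = Cexp z * Cexp w.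
Proof.
case: z w => [a b] [c d] /=; apply/eqP; rewrite eq_complex /= expRD cosD sinD.
by apply/andP; split; apply/eqP; ring.
Qed.

Lemma Cexp0 {R : realType} : Cexp (0 : R[i]) = 1.
Proof. by rewrite /Cexp /= expR0 cos0 sin0 mul1r. Qed.

Definition turn {R : realType} (x : R[i]) : R[i] :=
  Cexp ('i * (2%:R * Cpi R * x)).

Lemma turnD {R : realType} (x y : R[i]) : turn (x + y) = turn x * turn y.
Proof. by rewrite /turn !mulrDr CexpD. Qed.

Lemma turn0 {R : realType} : turn (0 : R[i]) = 1.
Proof. by rewrite /turn !mulr0 Cexp0. Qed.

Lemma turn_neq0 {R : realType} (x : R[i]) : turn x != 0.
Proof.
apply/eqP => x0; have := turnD x (- x).
by rewrite subrr turn0 x0 mul0r => /eqP; rewrite oner_eq0.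
Qed.

Lemma turnN {R : realType} (x : R[i]) : turn (- x) = (turn x)^-1.
Proof.
by apply: (mulfI (turn_neq0 x)); rewrite -turnD subrr turn0 divff ?turn_neq0.
Qed.

Lemma turnMn {R : realType} (x : R[i]) (n : nat) : turn (n%:R * x) = turn x ^+ n.
Proof.
elim: n => [|n IH]; first by rewrite mul0r turn0.
by rewrite -natr1 mulrDl mul1r turnD IH exprSr.
Qed.

Lemma turnE {R : realType} (a b : R) :
  turn (a +i* b) =
    (expR (- (pi *+ 2 * b)))%:C * (cos (pi *+ 2 * a) +i* sin (pi *+ 2 * a)).
Proof.
rewrite /turn.
have -> : 'i * (2%:R * Cpi R * (a +i* b)) = (- (pi *+ 2 * b)) +i* (pi *+ 2 * a).
  rewrite /Cpi mulr_natl; apply/eqP; rewrite eq_complex /=.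
  by apply/andP; split; apply/eqP; ring.
by [].
Qed.

Lemma turn_quarter {R : realType} : turn (4%:R^-1 : R[i]) = 'i.
Proof.
have -> : (4%:R^-1 : R[i]) = (4%:R^-1 : R) +i* 0 
    by rewrite -[RHS]/((4%:R^-1)%:C) fmorphV rmorph_nat.
rewrite turnE mulr0 oppr0 expR0 mul1r.
have -> : pi *+ 2 * 4%:R^-1 = pi / 2%:R :> R by field.
by rewrite cos_pihalf sin_pihalf.
Qed.

Lemma turn_half {R : realType} : turn (2%:R^-1 : R[i]) = -1.
Proof.
have -> : (2%:R^-1 : R[i]) = 2%:R * 4%:R^-1 by field.
by rewrite turnMn turn_quarter sqr_i.
Qed.

Lemma turn_int {R : realType} (k : int) : turn (k%:~R : R[i]) = 1.
Proof.
have nat1 (m : nat) : turn (m%:R : R[i]) = 1.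
  have -> : (m%:R : R[i]) = (m * 2)%:R * 2%:R^-1.
    by rewrite natrM mulfK ?pnatr_eq0.
  by rewrite turnMn turn_half mulnC exprM sqrrN expr1n expr1n.
by case: k => m; rewrite ?NegzE ?mulrNz ?turnN nat1 ?invr1.
Qed.

(** Modulo integers the real part is some [f] in [0, 1). The modulus is positive, so the sine of
    [2 pi f] vanishes and its cosine is positive, hence 1; then the modulus is 1 and [b = 0]. *)
Lemma turn_eq1 {R : realType} (x : R[i]) : turn x = 1 -> is_Cint x.
Proof.
case: x => a b x1; exists (Num.floor a).
have : turn ((a - (Num.floor a)%:~R) +i* b) = 1.
  rewrite -x1 -[RHS]mulr1 -(turn_int (- Num.floor a)) -turnD; congr turn.
  rewrite -(rmorph_int (real_complex R)).
  by apply/eqP; rewrite eq_complex /= mulrNz addr0 !eqxx.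
have /andP [] := floor_itv a; rewrite -subr_ge0 intrD -ltrBlDl.
set f := a - _ => f0 f1; rewrite turnE => /eqP; rewrite eq_complex /=.
rewrite !mul0r subr0 addr0 => /andP [/eqP E1 /eqP E2].
have e0 := expR_gt0 (- (pi *+ 2 * b)).
have s0 : sin (pi *+ 2 * f) = 0.
  by apply/eqP; move/eqP: E2; rewrite mulf_eq0 (gt_eqF e0).
have c0 : 0 < cos (pi *+ 2 * f) by rewrite -(pmulr_rgt0 _ e0) E1.
have c1 : cos (pi *+ 2 * f) = 1.
  by have := sin0cos1 s0; rewrite gtr0_norm.
(* The half angle [pi f] lies in [0, pi), where the sine vanishes only at 0. *)
have pf0 : sin (pi * f) = 0.
  have := c1; rewrite mulrnAl cos_mulr2n cos2sin2 => h.
  by apply/eqP; rewrite -sqrf_eq0; apply/eqP; lra.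
have f_eq0 : f = 0.
  apply/eqP/negPn/negP => fn0; have f_gt0 : 0 < f by rewrite lt_def fn0.
  have := @sin_gt0_pi _ (pi * f); rewrite pf0 ltxx.
  rewrite (mulr_gt0 (pi_gt0 R) f_gt0) gtr_pMr ?pi_gt0 // f1 => /(_ isT) //.
have b0 : b = 0.
  move: E1; rewrite c1 mulr1 -expR0 => /expR_inj /eqP.
  by rewrite oppr_eq0 mulf_eq0 mulrn_eq0 /= (gt_eqF (pi_gt0 R)) => /eqP.
rewrite b0 -(rmorph_int (real_complex R)).
by move/eqP: f_eq0; rewrite subr_eq0 => /eqP {1}->.
Qed.

Lemma Csin_turn {R : realType} (x : R[i]) :
  Csin (2%:R * Cpi R * x) = (turn x - (turn x)^-1) / (2%:R * 'i).
Proof. by rewrite -turnN /turn !mulrN. Qed.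

Lemma Ccos_turn {R : realType} (x : R[i]) :
  Ccos (2%:R * Cpi R * x) = (turn x + (turn x)^-1) / 2%:R.
Proof. by rewrite -turnN /turn !mulrN. Qed.

(** If the power [k.+1 <= n] equals 1, then [k.+1 / n] is an integer, which forces [k.+1 = n]. *)
Lemma turn_prim_root {R : realType} (n : nat) :
  (0 < n)%N -> n.-primitive_root (turn (n%:R^-1 : R[i])).
Proof.
move=> n_gt0; have nC : (n%:R : R[i]) != 0 by rewrite pnatr_eq0 -lt0n.
apply/andP; split=> //; apply/forallP => k; rewrite unity_rootE; apply/eqP.
case: (eqVneq k.+1 n) => [->|kn].
  by rewrite -turnMn divff // (turn_int 1) eqxx.
apply/negbTE/negP; rewrite -turnMn => /eqP /turn_eq1 [m /(canRL (mulfVK nC))] E.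
have {}E : k.+1%:Z = m * n%:Z.
  by apply: (@intr_inj R[i]); rewrite intrM -!pmulrn.
have : (n %| k.+1)%N by have := dvdz_mull m (dvdzz n%:Z); rewrite -E dvdzE.
by move/(dvdn_leq (ltn0Sn _)); have := ltn_ord k; lia.
Qed.

(** * The two trigonometric identities *)

(** Both identities at once: [s] is the sign of the cosine, and the hypotheses keep the partial
    fractions at [turn x] finite. *)
Lemma sum_inv_trig {R : realType} (n : nat) (s x : R[i]) :
  odd n -> s ^+ 2 = 1 -> turn x + s != 0 -> turn x + (-1) ^+ n./2 * 'i != 0 ->
  \sum_(0 <= r < n)
    1 / (1 + Csin (2%:R * Cpi R * ((x + r%:R) / n%:R))
           + s * Ccos (2%:R * Cpi R * ((x + r%:R) / n%:R)))
  = (-1) ^+ n./2 * n%:R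
    / (1 + (-1) ^+ n./2 * Csin (2%:R * Cpi R * x) + s * Ccos (2%:R * Cpi R * x)).
Proof.
move=> n_odd s2 xs xi; have n_gt0 := odd_gt0 n_odd.
have nC : (n%:R : R[i]) != 0 by rewrite pnatr_eq0 -lt0n.
set c := (-1) ^+ n./2 in xi *.
have c2 : c ^+ 2 = 1 by rewrite /c -exprM mulnC exprM sqrrN !expr1n.
have i2 : 'i ^+ 2 = -1 :> R[i] := sqr_i R.
have nE : n = (n./2 * 2).+1 by rewrite muln2 -[LHS]odd_double_half n_odd.
have s_pred : s ^+ n.-1 = 1 by rewrite [in LHS]nE /= mulnC exprM s2 expr1n.
have sn : s ^+ n = s by rewrite -(prednK n_gt0) exprS s_pred mulr1.
have i_pred : 'i ^+ n.-1 = c by rewrite [in LHS]nE /= mulnC exprM i2.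
have i_n : 'i ^+ n = c * 'i by rewrite -(prednK n_gt0) exprSr i_pred.
have prim := @turn_prim_root R n n_gt0.
set zeta := turn _ in prim; pose z := turn (x / n%:R).
have zn : z ^+ n = turn x by rewrite /z -turnMn mulrC divfK.
have uE r : turn ((x + r%:R) / n%:R) = z * zeta ^+ r.
  by rewrite mulrDl turnD turnMn.
have un r : (z * zeta ^+ r) ^+ n = turn x.
  by rewrite exprMn zn exprAC (prim_expr_order prim) expr1n mulr1.
(* If [z zeta^r = - a], the odd power [n] gives [turn x = - a ^+ n]; so nonvanishing at [x] passes
   to every summand. *)
have nz (a : R[i]) r : turn x + a ^+ n != 0 -> z * zeta ^+ r + a != 0.
  apply: contraNneq => /eqP; rewrite addr_eq0 => /eqP uN.
  by rewrite -(un r) uN exprNn -signr_odd n_odd mulN1r addNr.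
transitivity (\sum_(r < n)
    (s * (z * zeta ^+ r + 'i)^-1 + 'i * (z * zeta ^+ r + s)^-1)).
  rewrite big_mkord; apply: eq_bigr => r _.
  rewrite Csin_turn Ccos_turn uE.
  have := @inv_trig_partial_fractions _ 'i (z * zeta ^+ r) 1 s i2.
  rewrite !mul1r mulr1; apply=> //; last by apply: nz; rewrite sn.
  - by rewrite -uE turn_neq0.
  - by rewrite expr1n.
  - by apply: nz; rewrite i_n.
rewrite big_split /= -!mulr_sumr !sum_inv_prim_root // zn ?sn ?i_n //.
(* The right-hand side is expanded by the same partial fractions, now at [turn x] with sign [c]. *)
rewrite s_pred i_pred Csin_turn Ccos_turn [RHS]mulrAC.
rewrite (inv_trig_partial_fractions _ _ _ _ _ i2) ?turn_neq0 //.
by field; rewrite xs xi.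
Qed.

(** Converts the integrality hypotheses into nonzero denominators: [y] will be 1/2, 0 or a signed
    quarter, where [turn (- y)] is -1, 1 or a signed ['i]. *)
Lemma turn_addr_neq0 {R : realType} (x y : R[i]) :
  ~ is_Cint (x + y) -> turn x - turn (- y) != 0.
Proof.
move=> nint; rewrite subr_eq0; apply/eqP => E; apply: nint; apply: turn_eq1.
by rewrite turnD E -turnD addNr turn0.
Qed.

Lemma turn_signed_quarter {R : realType} (m : nat) :
  turn (- ((-1) ^+ m / 4%:R) : R[i]) = - ((-1) ^+ m * 'i).
Proof.
have iV : 'i^-1 = - 'i :> R[i].
  have i0 : 'i != 0 :> R[i] by rewrite eq_complex /= oner_eq0 andbF.
  by apply: (mulfI i0); rewrite mulrN -expr2 sqr_i opprK divff.
rewrite -signr_odd; case: (odd m); rewrite ?expr1 ?expr0 !(mulN1r, mul1r).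
  by rewrite !opprK turn_quarter.
by rewrite turnN turn_quarter iV.
Qed.

Theorem theorem1p1 (R : realType) (n : nat) (hn : odd n) :
  (forall x : R[i],
     ~ is_Cint (x + 1 / 2%:R) ->
     ~ is_Cint (x + (-1) ^+ ((n - 1) %/ 2) / 4%:R) ->
     \sum_(0 <= r < n)
        1 / (1 + Csin (2%:R * Cpi R * ((x + r%:R) / n%:R))
               + Ccos (2%:R * Cpi R * ((x + r%:R) / n%:R)))
     = (jacobi (-1) n)%:~R * n%:R
       / (1 + (jacobi (-1) n)%:~R * Csin (2%:R * Cpi R * x)
            + Ccos (2%:R * Cpi R * x)))
  /\
  (forall x : R[i],
     ~ is_Cint x ->
     ~ is_Cint (x + (-1) ^+ ((n - 1) %/ 2) / 4%:R) ->
     \sum_(0 <= r < n)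
        1 / (1 + Csin (2%:R * Cpi R * ((x + r%:R) / n%:R))
               - Ccos (2%:R * Cpi R * ((x + r%:R) / n%:R)))
     = (jacobi (-1) n)%:~R * n%:R
       / (1 + (jacobi (-1) n)%:~R * Csin (2%:R * Cpi R * x)
            - Ccos (2%:R * Cpi R * x))).
Proof.
have jE : (jacobi (-1) n)%:~R = (-1) ^+ n./2 :> R[i].
  by rewrite (jacobiN1 _ hn) rmorphXn rmorphN1.
have halfE : ((n - 1) %/ 2 = n./2)%N by lia.
rewrite jE halfE; split=> x h1 /turn_addr_neq0; rewrite turn_signed_quarter opprK => xi.
- have := turn_addr_neq0 _ _ h1; rewrite mul1r turnN turn_half invrN1 opprK => xs.
  under eq_bigr do rewrite -[Ccos _]mul1r.
  by rewrite (sum_inv_trig n 1 x hn) ?expr1n // mul1r.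
- have := turn_addr_neq0 x 0; rewrite addr0 oppr0 turn0 => /(_ h1) xs.
  under eq_bigr do rewrite -mulN1r.
  by rewrite (sum_inv_trig n (-1) x hn) ?sqrrN ?expr1n // mulN1r.
Qed.
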